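(* Let $k\in\mathbb N$, let $M_i=(J,\Sigma,\mu,\mathcal F_i)$, $i\in[k]$, be measurable matroids on the same standard measure space with rank functions $r_i$, and let $A\in\Sigma$. Let $M_\vee=\bigvee_{i=1}^kM_i$ be their measurable union, with rank function $r_\vee$. Suppose that there exists $\varepsilon>0$ such that $$\sum_{i=1}^k r_i(X)\ \ge\ \min\Big\{\sum_{i=1}^k r_i(A),\ (1+\varepsilon)\mu(X)\Big\}$$ for every measurable $X\subseteq A$. Then there exist pairwise disjoint sets $F_i\in\mathcal F_i$ with $F_i\subseteq A$, for $i\in[k]$, such that $$\mu\Big(\bigcup_{i=1}^kF_i\Big)=\min\Big\{\mu(A),\ \sum_{i=1}^k r_i(A)\Big\}.$$ Consequently, $$r_\vee(A)=\min\Big\{\mu(A),\ \sum_{i=1}^k r_i(A)\Big\},$$ and $\bigcup_{i=1}^kF_i$ is a basis of the restriction $M_\vee|A$ which belongs to $\mathcal F_1+\dots+\mathcal F_k$.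
   Context: A standard measure space $(J,\Sigma,\mu)$ is a standard Borel space $(J,\Sigma)$ with a finite atomless measure $\mu\colon\Sigma\to[0,\infty)$. Convention: measurable sets are identified when they differ by a $\mu$-null set: $A=B$ means $\mu(A\triangle B)=0$, $A\subseteq B$ means $\mu(A\setminus B)=0$, and families of measurable sets are families in the measure algebra (membership is unaffected by null modifications). A set $X$ in a family $\mathcal X$ is maximal in $\mathcal X$ if $X\subseteq Y\in\mathcal X$ implies $Y\subseteq X$. Write $\mathcal X|Z=\{X\in\mathcal X\mid X\subseteq Z\}$ and $[k]=\{1,\dots,k\}$. A measurable matroid $M=(J,\Sigma,\mu,\mathcal F)$ consists of a standard measure space and a family $\mathcal F\subseteq\Sigma$ (the independent sets) satisfying: (I1) $\emptyset\in\mathcal F$; (I2) $F_1\subseteq F_2\in\mathcal F$ implies $F_1\in\mathcal F$; (I3) for all $X\in\Sigma$ and all maximal $F_1,F_2\in\mathcal F|X$, $\mu(F_1)=\mu(F_2)$; (I4) if $(F_i)_{i\in\mathbb N}$ is an increasing sequence in $\mathcal F$, then $\bigcup_i F_i\in\mathcal F$. Bases are the maximal members of $\mathcal F$. The rank function is $r(X)=\mu(F)$ for any maximal $F\in\mathcal F|X$ (such $F$ exists and the value does not depend on the choice). The restriction $M|A$ is $(A,\Sigma|A,\mu|A,\mathcal F|A)$. For families $\mathcal S_1,\dots,\mathcal S_k\subseteq\Sigma$, $\mathcal S_1+\dots+\mathcal S_k=\{S_1\cup\dots\cup S_k\mid S_i\in\mathcal S_i\}$. The upward closure of $\mathcal X\subseteq\Sigma$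 is $\overline{\mathcal X}=\{\bigcup_{i=1}^\infty X_i\mid (X_i)_{i\in\mathbb N}\text{ increasing in }\mathcal X\}$. The measurable union $\bigvee_{i=1}^kM_i$ is $(J,\Sigma,\mu,\overline{\mathcal F_1+\dots+\mathcal F_k})$, which is a measurable matroid. *)

(* Defs.v *)
From HB Require Import structures.
From mathcomp Require Import all_boot all_order all_algebra.
From mathcomp Require Import all_classical all_reals all_analysis.

Set Implicit Arguments.
Unset Strict Implicit.
Unset Printing Implicit Defensive.

Import Order.TTheory GRing.Theory Num.Theory.
Local Open Scope classical_set_scope.
Local Open Scope ring_scope.
Local Open Scope ereal_scope.

(* Isomorphic, as a measurable space, to the Borel space of a Polish space P;
   a Hausdorff pseudometric space is a metric space. *)
Definition standard_borel (R : realType) (d : measure_display)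
    (J : measurableType d) : Prop :=
  exists (P : completePseudoMetricType R) (f : J -> P),
    [/\ hausdorff_space P,
        (exists2 D : set P, countable D & dense D),
        bijective f &
        forall A : set J, measurable A <-> <<s @open P >> (f @` A)].

Section MeasurableMatroids.
Context {R : realType} {d : measure_display} {J : measurableType d}.
Variable mu : {finite_measure set J -> \bar R}.

Definition atomless : Prop :=
  forall A : set J, measurable A -> 0 < mu A ->
    exists B : set J, [/\ measurable B, B `<=` A, 0 < mu B & mu B < mu A].

Definition standard_measure_space : Prop := standard_borel R J /\ atomless.

(* Measurable sets are identified modulo null sets: every inclusion and
   equality of measurable sets below is one of the following two relations.
   They are only used on measurable sets. *)
Definition ae_subset (A B : set J) : Prop := mu (A `\` B) = 0.
Definition ae_same (A B : set J) : Prop := mu (A `+` B) = 0.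

Implicit Types XX : set (set J).

Definition maximal_in XX (X : set J) : Prop :=
  XX X /\ forall Y : set J, XX Y -> ae_subset X Y -> ae_subset Y X.

(* The family X|Z; for the independent sets of a matroid M this is the family
   of independent sets of the restriction M|Z. *)
Definition restr XX (Z : set J) : set (set J) :=
  [set X | XX X /\ ae_subset X Z].

(* Since [matroid_hereditary] uses inclusion modulo null sets, membership in XX
   is automatically unaffected by null modifications. *)
Record measurable_matroid XX : Prop := {
  matroid_measurable : XX `<=` measurable ;
  matroid_empty : XX set0 ;
  matroid_hereditary : forall F1 F2 : set J,
    measurable F1 -> ae_subset F1 F2 -> XX F2 -> XX F1 ;
  matroid_maximal : forall X F1 F2 : set J, measurable X ->
    maximal_in (restr XX X) F1 -> maximal_in (restr XX X) F2 ->
    mu F1 = mu F2 ;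
  matroid_closed : forall S : nat -> set J,
    (forall n, XX (S n)) -> (forall n, ae_subset (S n) (S n.+1)) ->
    XX (\bigcup_n S n) }.

Definition matroid_basis XX (B : set J) : Prop := maximal_in XX B.

(* The measure of a chosen maximal member of XX|X. *)
Definition rank XX (X : set J) : \bar R :=
  mu (xget set0 [set F | maximal_in (restr XX X) F]).

Definition sum_family (k : nat) (SS : 'I_k -> set (set J)) : set (set J) :=
  [set X | measurable X /\
     exists S : 'I_k -> set J,
       (forall i, SS i (S i)) /\ ae_same X (\bigcup_i S i)].

Definition upward_closure XX : set (set J) :=
  [set X | measurable X /\
     exists S : nat -> set J,
       [/\ forall n, XX (S n),
           forall n, ae_subset (S n) (S n.+1) &
           ae_same X (\bigcup_n S n)]].

Definition measurable_union (k : nat) (FF : 'I_k -> set (set J)) :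
    set (set J) :=
  upward_closure (sum_family FF).

End MeasurableMatroids.

(* Main.v *)
Require Import Defs.
From HB Require Import structures.
From mathcomp Require Import all_boot all_order all_algebra.
From mathcomp Require Import all_classical all_reals all_analysis.
From mathcomp Require Import zify lra.

Set Implicit Arguments.
Unset Strict Implicit.
Unset Printing Implicit Defensive.

Import Order.TTheory GRing.Theory Num.Theory.
Local Open Scope classical_set_scope.
Local Open Scope ring_scope.

(** The proof augments a packing, a family of disjoint independent sets F_i
    inside A, along short paths, and passes to a limit.

    Let U be the part of A that a packing F leaves uncovered, and put S_0 = U.
    As long as no positive part of S_n can be added to some F_i, each F_i has a
    smallest subset G_i that spans S_n; these G_i are the sets of elements which
    can leave F_i in exchange for elements of S_n, and S_(n+1) is the union of
    U and all the G_i.  Since mu(G_i) >= r_i(S_n), the hypothesis gives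
    mu(S_(n+1)) >= (1 + eps) mu(S_n), unless F already has total measure
    sum_i r_i(A).  As S_n stays inside A, after n = O(log(mu(A) / mu(U))) steps
    some positive part of S_n can be added to some F_i.  Exchanging back from
    S_n down to U covers a new set X of positive measure, at the price of
    changing F on a set of measure at most (2n + 1) mu(X) ([reroutable_step],
    [augment]).  In a measurable matroid an exchange is only available between
    small sets of equal measure, and rank arguments replace circuits
    ([exchange_within], [exchange_superset]).

    Since (2n + 1) sqrt(mu(U)) is bounded ([path_cost_le]), the measure of the
    change is at most a constant times the decrease of sqrt(mu(U)).  Hence a
    variational principle of Ekeland type applies: infinite sequences of such
    improvements have a finite total change, so they converge, and the limit
    (the elements that eventually stay in F_i) is a packing because independent
    families are closed under increasing unions ([improves_limit]).  The
    principle yields a packing that admits no improvement, and it covers measure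
    min(mu(A), sum_i r_i(A)) ([saturating_packing]).

    Augmentation never uncovers anything, so the packing can be made to cover
    any given packed set.  The slack hypothesis passes to subsets of A, so each
    independent set of the union inside A is itself packed exactly.  Together
    these show that all maximal independent sets of the union inside A have the
    measure above ([maximal_union_meas]). *)

(** * A maximality principle *)

(** At stage n move above the current point to within 1/(n+1) of the infimum of
    u there: an upper bound of the resulting sequence leaves no room for a
    further decrease of u. *)
Lemma brezis_browder (R : realType) (T : Type) (le : T -> T -> Prop)
    (u : T -> R) (c : R) :
  (forall x, le x x) ->
  (forall x y z, le x y -> le y z -> le x z) ->
  (forall x, c <= u x) ->
  (forall x y, le x y -> u y <= u x) ->
  (forall s : nat -> T, (forall n, le (s n) (s n.+1)) ->
     exists y, forall n, le (s n) y) ->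
  forall x0, exists y, le x0 y /\ forall z, le y z -> u z = u y.
Proof.
move=> lexx letr ulb umon ubseq x0.
have step (n : nat) (x : T) :
    exists y, le x y /\ forall z, le x z -> u y <= u z + n.+1%:R^-1.
  pose V := [set u z | z in le x].
  have hV : has_inf V.
    split; first by exists (u x), x.
    by exists c => _ [z _ <-].
  have n0 : 0 < n.+1%:R^-1 :> R by rewrite invr_gt0 ltr0n.
  have [_ [y xy <-] yV] := inf_adherent n0 hV.
  exists y; split=> // z xz; apply: le_trans (ltW yV) _.
  by rewrite lerD2r; apply: ge_inf; [case: hV | exists z].
have /choice[f fP] : forall p : nat * T, exists y, le p.2 y /\
    forall z, le p.2 z -> u y <= u z + p.1.+1%:R^-1.
  by move=> [n x]; exact: step.
pose s := fix s n := if n is p.+1 then f (p, s p) else x0.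
have [y sy] : exists y, forall n, le (s n) y.
  by apply: ubseq => n; have [] := fP (n, s n).
exists y; split=> [|z yz]; first exact: (sy 0%N).
apply/eqP; rewrite eq_le umon //=; apply/ler_addgt0Pr => e e0.
have [n nP] : exists n : nat, n.+1%:R^-1 < e.
  by have [n _ /(_ n (leqnn n))] := near_infty_natSinv_lt (PosNum e0); exists n.
have [_ /(_ z) h] := fP (n, s n).
apply: le_trans (umon _ _ (sy n.+1)) _.
apply: le_trans (h _) _; first exact: letr (sy n) yz.
by rewrite lerD2l ltW.
Qed.

Lemma brezis_browder_in (R : realType) (T : Type) (P : T -> Prop)
    (le : T -> T -> Prop) (u : T -> R) (c : R) :
  (forall x, le x x) ->
  (forall x y z, P x -> P y -> P z -> le x y -> le y z -> le x z) ->
  (forall x, P x -> c <= u x) ->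
  (forall x y, P x -> P y -> le x y -> u y <= u x) ->
  (forall s : nat -> T, (forall n, P (s n)) -> (forall n, le (s n) (s n.+1)) ->
     exists2 y, P y & forall n, le (s n) y) ->
  forall x0, P x0 ->
    exists y, [/\ P y, le x0 y & forall z, P z -> le y z -> u z = u y].
Proof.
move=> lexx letr ulb umon ubseq x0 Px0.
pose mk x (Px : P x) : {x : T | P x} := exist _ x Px.
have [||||s smon|[y Py] [/= x0y ymax]] := @brezis_browder R {x : T | P x}
  (fun x y => le (sval x) (sval y)) (fun x => u (sval x)) c _ _ _ _ _ (mk _ Px0).
- by move=> x.
- by move=> [x Px] [y Py] [z Pz] /=; exact: letr.
- by move=> [x Px]; exact: ulb.
- by move=> [x Px] [y Py]; exact: umon.
- have [y Py ys] := ubseq (sval \o s) (fun n => svalP (s n)) smon.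
  by exists (mk _ Py).
- by exists y; split=> // z Pz; exact: (ymax (mk _ Pz)).
Qed.

(** * Finite measures with real values *)

Ltac solve_measurable :=
  solve [ done | exact: measurable0
        | apply: measurableU; solve_measurable
        | apply: measurableD; solve_measurable
        | apply: measurableI; solve_measurable ].

Section FiniteMeasure.
Context {R : realType} {d : measure_display} {J : measurableType d}.
Variable mu : {finite_measure set J -> \bar R}.

(** Real values make [lra] applicable. *)
Definition meas (X : set J) : R := fine (mu X).

Lemma measE X : measurable X -> mu X = (meas X)%:E.
Proof. by move=> mX; rewrite /meas fineK// fin_num_measure. Qed.

Lemma meas_ge0 X : 0 <= meas X.
Proof. by rewrite /meas fine_ge0. Qed.

Lemma meas0 : meas set0 = 0.
Proof. by rewrite /meas measure0. Qed.

Lemma meas_eq0 X : measurable X -> (mu X = 0%E) <-> (meas X = 0).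
Proof. by move=> mX; rewrite measE//; split=> [[]|->]. Qed.

Lemma meas_le X Y : measurable X -> measurable Y -> X `<=` Y ->
  meas X <= meas Y.
Proof.
by move=> mX mY XY; rewrite -lee_fin -!measE//; apply: le_measure; rewrite ?inE.
Qed.

Lemma measU X Y : measurable X -> measurable Y -> X `&` Y = set0 ->
  meas (X `|` Y) = meas X + meas Y.
Proof.
move=> mX mY XY0; apply/EFin_inj; rewrite EFinD -!measE//; last exact: measurableU.
by rewrite measureU.
Qed.

Lemma measDI X Y : measurable X -> measurable Y ->
  meas X = meas (X `\` Y) + meas (X `&` Y).
Proof.
move=> mX mY; have e : (X `\` Y) `&` (X `&` Y) = set0.
  by rewrite setDE setIACA setICl setI0.
by rewrite -{1}(setUIDK X Y) setUC measU//; solve_measurable.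
Qed.

Lemma measD X Y : measurable X -> measurable Y -> Y `<=` X ->
  meas (X `\` Y) = meas X - meas Y.
Proof. by move=> mX mY /setIidPr YX; rewrite (measDI mX mY) YX addrK. Qed.

Lemma measU_le X Y : measurable X -> measurable Y ->
  meas (X `|` Y) <= meas X + meas Y.
Proof.
move=> mX mY; rewrite -lee_fin EFinD -!measE//; last exact: measurableU.
exact: measureU2.
Qed.

Lemma meas_bigcup_le (S : nat -> set J) c :
  (forall n, measurable (S n)) -> (forall n, S n `<=` S n.+1) ->
  (forall n, meas (S n) <= c) -> meas (\bigcup_n S n) <= c.
Proof.
move=> mS Smon Sc; have mUS := bigcup_measurable (fun n _ => mS n) : measurable (\bigcup_n S n).
rewrite -lee_fin -measE//.
have cvgS : (mu \o S) @ \oo --> mu (\bigcup_n S n).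
  apply: nondecreasing_cvg_mu => //; apply/nondecreasing_seqP => n.
  exact/subsetPset.
rewrite -(cvg_lim _ cvgS)//; apply: lime_le; first by apply/cvg_ex; eexists; exact: cvgS.
by apply: nearW => n /=; rewrite measE// lee_fin.
Qed.

Lemma meas_bigcap_ge (S : nat -> set J) c :
  (forall n, measurable (S n)) -> (forall n, S n.+1 `<=` S n) ->
  (forall n, c <= meas (S n)) -> c <= meas (\bigcap_n S n).
Proof.
move=> mS Smon Sc.
have mC n : measurable (S 0%N `\` S n) by exact: measurableD.
have S0n n : S n `<=` S 0%N.
  by elim: n => // n; apply: subset_trans.
have mI : measurable (\bigcap_n S n) by exact: bigcap_measurable.
have := @meas_bigcup_le (fun n => S 0%N `\` S n) (meas (S 0%N) - c) mC.
have -> : \bigcup_n (S 0%N `\` S n) = S 0%N `\` \bigcap_n S n.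
  by rewrite setDE setC_bigcap setI_bigcupr.
rewrite measD//; last by move=> x /(_ 0%N I).
move=> h; have : meas (S 0%N) - meas (\bigcap_n S n) <= meas (S 0%N) - c.
  apply: h => n; first by move=> x [? ?]; split=> // /Smon.
  by rewrite measD// lerD2l lerN2.
by rewrite lerD2l lerN2.
Qed.

Lemma bigcup_bigsetU k (F : 'I_k -> set J) :
  \bigcup_i F i = \big[setU/set0]_(i < k) F i.
Proof.
rewrite -bigcup_seq; congr bigcup; apply/seteqP; split=> // i _ /=.
by rewrite mem_index_enum.
Qed.

Lemma bigcupI_measurable k (F : 'I_k -> set J) :
  (forall i, measurable (F i)) -> measurable (\bigcup_i F i).
Proof. by move=> mF; rewrite bigcup_bigsetU; apply: bigsetU_measurable. Qed.

Lemma meas_bigcup_sum_le k (F : 'I_k -> set J) :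
  (forall i, measurable (F i)) -> meas (\bigcup_i F i) <= \sum_(i < k) meas (F i).
Proof.
move=> mF; rewrite bigcup_bigsetU.
suff [] : measurable (\big[setU/set0]_(i < k) F i) /\
  meas (\big[setU/set0]_(i < k) F i) <= \sum_(i < k) meas (F i) by [].
elim/big_rec2 : _ => [|i y X _ [mX Xy]]; first by rewrite meas0.
split; first solve_measurable.
by apply: le_trans (measU_le (mF i) mX) _; rewrite lerD2l.
Qed.

Lemma meas_bigcup_sum k (F : 'I_k -> set J) :
  (forall i, measurable (F i)) -> (forall i j, i != j -> F i `&` F j = set0) ->
  meas (\bigcup_i F i) = \sum_(i < k) meas (F i).
Proof.
move=> mF dF; rewrite bigcup_bigsetU; apply/EFin_inj.
rewrite -measE; last by apply: bigsetU_measurable.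
rewrite measure_bigsetU_ord//; last first.
  by apply/trivIsetP => i j _ _; exact: dF.
by rewrite -sumEFin; apply: eq_bigr => i _; exact: measE.
Qed.


Lemma meas_bigcup_series_le (E : nat -> set J) (c : R) :
  (forall n, measurable (E n)) ->
  (forall p, \sum_(n < p) meas (E n) <= c) -> meas (\bigcup_n E n) <= c.
Proof.
move=> mE Ec; rewrite -bigcup_bigsetU_bigcup.
have mS p : measurable (\big[setU/set0]_(n < p) E n) by exact: bigsetU_measurable.
apply: meas_bigcup_le => //.
  by move=> p; rewrite [X in _ `<=` X]big_ord_recr/=; exact: subsetUl.
move=> p; apply: le_trans (Ec p.+1); elim: p.+1 => [|q ih].
  by rewrite !big_ord0 meas0.
rewrite !big_ord_recr/=; apply: le_trans (measU_le (mS q) (mE q)) _.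
by rewrite lerD2r.
Qed.

(** * The rank function *)

Section Rank.
Variable FF : set (set J).
Hypothesis M : measurable_matroid mu FF.

Definition rk (X : set J) : R := fine (rank mu FF X).

Lemma sub_ae_subset (X Y : set J) : X `<=` Y -> ae_subset mu X Y.
Proof. by move=> XY; rewrite /ae_subset (_ : _ `\` _ = set0) ?measure0// setD_eq0. Qed.

Lemma indep_measurable X : FF X -> measurable X.
Proof. exact: (matroid_measurable M). Qed.

Lemma indep_sub X Y : measurable X -> FF Y -> X `<=` Y -> FF X.
Proof.
move=> mX fY XY; apply: (matroid_hereditary M) fY => //.
exact: sub_ae_subset.
Qed.

Lemma indep_bigcup (S : nat -> set J) : (forall n, FF (S n)) ->
  (forall n, S n `<=` S n.+1) -> FF (\bigcup_n S n).
Proof.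
move=> fS Smon; apply: (matroid_closed M) => // n.
exact: sub_ae_subset.
Qed.

Lemma ae_subsetE (X Y : set J) : measurable X -> measurable Y ->
  ae_subset mu X Y <-> meas (X `\` Y) = 0.
Proof. by move=> mX mY; apply: meas_eq0; solve_measurable. Qed.

(** Obtained by maximising the measure; increasing unions of independent sets
    supply the upper bounds. *)
Lemma maximal_extension I X : FF I -> measurable X -> I `<=` X ->
  exists B, [/\ FF B, I `<=` B, B `<=` X & maximal_in mu (restr mu FF X) B].
Proof.
move=> fI mX IX.
have [] := @brezis_browder_in R (set J)
   (fun B => FF B /\ B `<=` X) (fun B C => B `<=` C) (fun B => - meas B)
   (- meas X) _ _ _ _ _ I (conj fI IX).
- by move=> B x.
- by move=> B C D _ _ _ BC CD x /BC/CD.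
- move=> B [fB BX]; rewrite lerN2; apply: meas_le => //.
  exact: indep_measurable.
- move=> B C [fB BX] [fC CX] BC; rewrite lerN2; apply: meas_le => //;
  exact: indep_measurable.
- move=> s sX smon; exists (\bigcup_n s n); last by move=> n; exact: bigcup_sup.
  split; first by apply: indep_bigcup => // n; case: (sX n).
  by apply: bigcup_sub => n _; case: (sX n).
move=> B [[fB BX] IB Bmax]; exists B; split=> //; split.
  by split=> //; exact: sub_ae_subset.
move=> Y [fY YX] BY.
have mB := indep_measurable fB; have mY := indep_measurable fY.
have fC : FF (B `|` (Y `&` X)).
  apply: (matroid_hereditary M) fY; first solve_measurable.
  rewrite /ae_subset setDUl (_ : _ `&` _ `\` _ = set0) ?setU0//.
  by rewrite setD_eq0 => x [].
have CX : B `|` (Y `&` X) `<=` X by move=> x [/BX|[]].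
have /oppr_inj e := Bmax _ (conj fC CX) (@subsetUl _ _ _).
have mYB : measurable (Y `\` B) by solve_measurable.
move/ae_subsetE : YX => /(_ mY mX) YX.
apply/ae_subsetE => //; apply/eqP; rewrite eq_le meas_ge0 andbT.
have mC := indep_measurable fC.
have h : meas ((B `|` (Y `&` X)) `\` B) = 0 by rewrite measD// e subrr.
have : Y `\` B `<=` (Y `\` X) `|` ((B `|` (Y `&` X)) `\` B).
  move=> x [Yx Bx]; have [Xx|Xx] := pselect (X x); [right|by left].
  by split=> //; right.
move=> /(meas_le mYB) => /(_ _)/le_trans; apply; first solve_measurable.
by apply: le_trans (measU_le _ _) _; rewrite ?YX ?h ?addr0//; solve_measurable.
Qed.

(** Through this lemma and [indep_le_rk] the axiom that all maximal independent
    subsets of a set have equal measure enters the rest of the proof. *)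
Lemma rank_extension I X : FF I -> measurable X -> I `<=` X ->
  exists B, [/\ FF B, I `<=` B, B `<=` X & meas B = rk X].
Proof.
move=> fI mX IX; have [B [fB IB BX Bmax]] := maximal_extension fI mX IX.
exists B; split=> //; rewrite /rk /rank; case: xgetP => [C _ Cmax|].
  by rewrite /meas (matroid_maximal M mX Bmax Cmax).
by move=> /(_ B).
Qed.

Lemma rank_fin X : measurable X -> rank mu FF X = (rk X)%:E.
Proof.
move=> mX; rewrite /rk /rank; case: xgetP => [C _ [[fC _] _]|_].
  by rewrite fineK// fin_num_measure//; exact: indep_measurable.
by rewrite measure0.
Qed.

Lemma indep_le_rk I X : FF I -> measurable X -> I `<=` X -> meas I <= rk X.
Proof.
move=> fI mX IX; have [B [fB IB BX <-]] := rank_extension fI mX IX.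
by apply: meas_le => //; exact: indep_measurable.
Qed.

Lemma rk_le_meas X : measurable X -> rk X <= meas X.
Proof.
move=> mX; have [B [fB _ BX <-]] := rank_extension (matroid_empty M) mX (@sub0set _ X).
by apply: meas_le => //; exact: indep_measurable.
Qed.

Lemma rk_le X Y : measurable X -> measurable Y -> X `<=` Y -> rk X <= rk Y.
Proof.
move=> mX mY XY.
have [B [fB _ BX <-]] := rank_extension (matroid_empty M) mX (@sub0set _ X).
by apply: indep_le_rk => //; exact: subset_trans XY.
Qed.

Lemma rk_indep I : FF I -> rk I = meas I.
Proof.
move=> fI; have mI := indep_measurable fI.
by apply/eqP; rewrite eq_le rk_le_meas//= indep_le_rk.
Qed.

Lemma indep_of_rk X : measurable X -> meas X <= rk X -> FF X.
Proof.
move=> mX; have [B [fB _ BX <-]] := rank_extension (matroid_empty M) mX (@sub0set _ X).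
move=> XB; have mB := indep_measurable fB.
apply: (matroid_hereditary M) fB => //; apply/ae_subsetE => //.
by apply/eqP; rewrite eq_le meas_ge0 andbT measD// subr_le0.
Qed.

(** Extend a maximal independent subset B of X `&` Y to a maximal independent
    subset C of X `|` Y, and count the parts of C in X and in Y. *)
Lemma rk_submod X Y : measurable X -> measurable Y ->
  rk (X `|` Y) + rk (X `&` Y) <= rk X + rk Y.
Proof.
move=> mX mY; have mXY : measurable (X `&` Y) by solve_measurable.
have mUXY : measurable (X `|` Y) by solve_measurable.
have [B [fB _ BXY <-]] := rank_extension (matroid_empty M) mXY (@sub0set _ _).
have [C [fC BC CXY <-]] : exists C, [/\ FF C, B `<=` C, C `<=` X `|` Y & meas C = rk (X `|` Y)].
  by apply: rank_extension => // x /BXY [? _]; left.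
have mB := indep_measurable fB; have mC := indep_measurable fC.
have mCX : measurable (C `&` X) by solve_measurable.
have mCY : measurable (C `&` Y) by solve_measurable.
have h1 : meas (C `&` X) <= rk X.
  by apply: indep_le_rk => //; apply: indep_sub fC _.
have h2 : meas (C `&` Y) <= rk Y.
  by apply: indep_le_rk => //; apply: indep_sub fC _.
have h3 : meas C = meas (C `&` X `\` B) + meas B + meas (C `\` X).
  rewrite (measDI mC mX) addrC; congr (_ + _).
  by rewrite measD ?subrK// => x Bx; split; [exact: BC|case: (BXY _ Bx)].
have h4 : meas B + meas (C `\` X) <= meas (C `&` Y).
  rewrite -measU//; last 2 first.
  - solve_measurable.
  - by apply/seteqP; split=> // x [/BXY[? ?] []].
  apply: meas_le => //; first solve_measurable.
  move=> x [Bx|[Cx nX]]; first by split; [exact: BC|case: (BXY _ Bx)].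
  by split=> //; case: (CXY _ Cx).
have h5 : meas (C `&` X `\` B) + meas B = meas (C `&` X).
  by rewrite measD ?subrK// => x Bx; split; [exact: BC|case: (BXY _ Bx)].
lra.
Qed.

(** * Exchanges *)

(** The set G is the part of F reachable from S by exchanges; in a finite
    matroid it is the union of the fundamental circuits of S with respect to F,
    restricted to F.  Here it is a set of least measure among those spanning S;
    decreasing intersections of spanning sets still span because their ranks are
    squeezed by their measures. *)
Lemma minimal_span F S : FF F -> measurable S -> rk (F `|` S) <= meas F ->
  exists G, [/\ measurable G, F `&` S `<=` G, G `<=` F, rk (G `|` S) <= meas G &
    forall Y, measurable Y -> Y `<=` G `\` S -> 0 < meas Y ->
      meas (G `\` Y) < rk ((G `\` Y) `|` S)].
Proof.
move=> fF mS FS; have mF := indep_measurable fF.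
pose P G := [/\ measurable G, F `&` S `<=` G, G `<=` F & rk (G `|` S) <= meas G].
have [||||||G [[mG FSG GF GS] _ Gmin]] := @brezis_browder_in R (set J) P
  (fun G H => H `<=` G) meas 0 _ _ _ _ _ F.
- by move=> G x.
- by move=> G H K _ _ _ HG KH x /KH/HG.
- by move=> G _; exact: meas_ge0.
- by move=> G H [mG _ _ _] [mH _ _ _] HG; apply: meas_le.
- move=> s sP smon; exists (\bigcap_n s n); last by move=> n; exact: bigcap_inf.
  have ms n : measurable (s n) by case: (sP n).
  have mI : measurable (\bigcap_n s n) by exact: bigcap_measurable.
  split=> //.
  + by apply: sub_bigcap => n _; case: (sP n).
  + by move=> x /(_ 0%N I); case: (sP 0%N) => _ _ + _; apply.
  + apply: meas_bigcap_ge => // n; case: (sP n) => _ _ _; apply: le_trans.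
    apply: rk_le; [solve_measurable|by apply: measurableU|].
    by apply: setSU; exact: bigcap_inf.
- by split=> //; apply: subIsetl.
exists G; split=> // Y mY YGS Y0; rewrite ltNge; apply/negP => GYS.
have mGY : measurable (G `\` Y) by solve_measurable.
have /Gmin : P (G `\` Y).
  split=> //; last by move=> x [/GF].
  by move=> x FSx; split; [exact: FSG|move=> /YGS [_]; case: FSx].
move=> /(_ (@subDsetl _ _ _)); rewrite measD//; first by lra.
by move=> x /YGS[].
Qed.

(** Extending (G minus Y) plus X to full rank inside G `|` X gives back exactly
    a part of Y of the right measure, so that the two sides of an exchange can
    always be balanced without cutting sets to a prescribed size. *)
Lemma exchange_within G X Y : FF G -> measurable X -> measurable Y ->
  Y `<=` G -> X `&` G = set0 -> FF ((G `\` Y) `|` X) -> rk (G `|` X) <= meas G ->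
  exists Z, [/\ measurable Z, Z `<=` Y, meas Z = meas X & FF ((G `\` Z) `|` X)].
Proof.
move=> fG mX mY YG XG fI GX; have mG := indep_measurable fG.
have mGX : measurable (G `|` X) by solve_measurable.
have [B [fB IB BGX mB]] : exists B, [/\ FF B, (G `\` Y) `|` X `<=` B,
    B `<=` G `|` X & meas B = rk (G `|` X)].
  by apply: rank_extension => //; apply: setSU; exact: subDsetl.
have {}mB : meas B = meas G.
  by apply/eqP; rewrite mB eq_le GX indep_le_rk//; exact: subsetUl.
have bB := indep_measurable fB.
have Be : B = (G `\` (G `\` B)) `|` X.
  apply/seteqP; split=> x.
    by move=> Bx; case: (BGX _ Bx) => Gx; [left; split=> // -[]|right].
  by case=> [[Gx /not_andP[//|/contrapT]]|Xx] //; apply: IB; right.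
exists (G `\` B); split.
- solve_measurable.
- by move=> x [Gx Bx]; apply: contrapT => Yx; apply: Bx; apply: IB; left.
- have mGB : measurable (G `\` B) by solve_measurable.
  have mGGB : measurable (G `\` (G `\` B)) by solve_measurable.
  move: mB; rewrite {1}Be measU//; last first.
    by apply/seteqP; split=> // x [[Gx _] Xx]; rewrite -XG.
  by rewrite (measD mG mGB (@subDsetl _ _ _)); lra.
- by rewrite -Be.
Qed.

(** If removing Y destroys the span of S, then a positive part of S can replace
    a part of Y. *)
Lemma exchange_positive G S Y : FF G -> measurable S -> measurable Y ->
  rk (G `|` S) <= meas G ->
  Y `<=` G `\` S -> meas (G `\` Y) < rk ((G `\` Y) `|` S) ->
  exists X Z, [/\ measurable X, X `<=` S `\` G, 0 < meas X, measurable Z & Z `<=` Y]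
    /\ [/\ meas Z = meas X & FF ((G `\` Z) `|` X)].
Proof.
move=> fG mS mY GS YGS h; have mG := indep_measurable fG.
have YG : Y `<=` G by move=> x /YGS[].
have mGY : measurable (G `\` Y) by solve_measurable.
have fGY : FF (G `\` Y) by apply: indep_sub fG _ => //; exact: subDsetl.
have mGYS : measurable ((G `\` Y) `|` S) by solve_measurable.
have [B [fB IB BGX mB]] := rank_extension fGY mGYS (@subsetUl _ _ _).
have bB := indep_measurable fB.
pose X := B `\` (G `\` Y).
have mX : measurable X by rewrite /X; solve_measurable.
have XS : X `<=` S `\` G.
  move=> x [Bx nGYx]; case: (BGX _ Bx) => // Sx; split=> // Gx; apply: nGYx.
  by split=> // /YGS[].
have [|||Z [mZ ZY ZX fZ]] := @exchange_within G X Y fG mX mY YG.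
- by apply/seteqP; split=> // x [/XS[]].
- by rewrite /X setDUK.
- apply: le_trans GS; apply: rk_le; [solve_measurable|solve_measurable|].
  by apply: setUS => x /XS[].
- by exists X, Z; split=> //; split=> //; rewrite /X measD// subr_gt0 mB.
Qed.

(** The counterpart of [exchange_within] in which the removed set is given and
    the added set is found. *)
Lemma exchange_reverse G X Y Z : FF G -> measurable X ->
  measurable Z -> X `&` G = set0 -> Y `<=` G -> Z `<=` Y ->
  measurable Y -> meas Y = meas X -> FF ((G `\` Y) `|` X) -> rk (G `|` X) <= meas G ->
  exists W, [/\ measurable W, W `<=` X, meas W = meas Z & FF ((G `\` Z) `|` W)].
Proof.
move=> fG mX mZ XG YG ZY mY YX fI GX; have mG := indep_measurable fG.
have mGZ : measurable (G `\` Z) by solve_measurable.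
have mGY : measurable (G `\` Y) by solve_measurable.
have fGZ : FF (G `\` Z) by apply: indep_sub fG _ => //; exact: subDsetl.
have mGZX : measurable ((G `\` Z) `|` X) by solve_measurable.
have [B [fB IB BGX mB]] := rank_extension fGZ mGZX (@subsetUl _ _ _).
have bB := indep_measurable fB.
have ZG : Z `<=` G by apply: subset_trans YG.
have {}mB : meas B = meas G.
  apply/eqP; rewrite mB eq_le; apply/andP; split.
    apply: le_trans GX; apply: rk_le => //; first solve_measurable.
    by apply: setSU; exact: subDsetl.
  have -> : meas G = meas ((G `\` Y) `|` X).
    rewrite measU// ?measD//; first by lra.
    by apply/seteqP; split=> // x [[Gx _] Xx]; rewrite -XG.
  by apply: indep_le_rk => //; apply: setSU => x [Gx Yx]; split=> // /ZY.
exists (B `\` (G `\` Z)); split.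
- solve_measurable.
- by move=> x [Bx nx]; case: (BGX _ Bx).
- by rewrite measD// measD//; lra.
- by rewrite setDUK.
Qed.

(** Since X is spanned by G, an exchange inside G stays valid in every
    independent set containing G.  Hence exchanges made at different levels of
    an augmenting path do not interfere, although they may use the same
    matroid. *)
Lemma exchange_superset F G X Y : FF F -> G `<=` F -> measurable G ->
  measurable X -> measurable Y -> Y `<=` G -> X `&` F = set0 -> meas X = meas Y ->
  rk (G `|` X) <= meas G -> FF ((G `\` Y) `|` X) -> FF ((F `\` Y) `|` X).
Proof.
move=> fF GF mG mX mY YG XF XY GX fI; have mF := indep_measurable fF.
have YF : Y `<=` F by exact: subset_trans GF.
have mFY : measurable (F `\` Y) by solve_measurable.
have mGY : measurable (G `\` Y) by solve_measurable.
have mFYX : measurable ((F `\` Y) `|` X) by solve_measurable.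
have mGX' : measurable (G `|` X) by solve_measurable.
have FX0 : (F `\` Y) `&` X = set0.
  by apply/seteqP; split=> // x [[Fx _] Xx]; rewrite -XF.
have GX0 : (G `\` Y) `&` X = set0.
  by apply/seteqP; split=> // x [[/GF Fx _] Xx]; rewrite -XF.
apply: indep_of_rk => //.
have := rk_submod mFYX mGX'.
have : meas F <= rk (((F `\` Y) `|` X) `|` (G `|` X)).
  apply: indep_le_rk => //; first solve_measurable.
  by move=> x Fx; have [/YG|] := pselect (Y x); [right; left|left; left].
have : rk ((G `\` Y) `|` X) <= rk (((F `\` Y) `|` X) `&` (G `|` X)).
  apply: rk_le; [solve_measurable|solve_measurable|].
  by move=> x [[Gx Yx]|Xx]; split; [left; split=> //; exact: GF|left|right|right].
rewrite (rk_indep fI) !measU// !measD//; lra.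
Qed.

Lemma span_indep_null F G S X : FF F -> G `<=` F -> measurable G -> measurable S ->
  measurable X -> X `<=` S `\` G -> rk (G `|` S) <= meas G -> meas (X `&` F) = 0.
Proof.
move=> fF GF mG mS mX XSG GS; have mF := indep_measurable fF.
have mXF : measurable (X `&` F) by solve_measurable.
have : meas (G `|` (X `&` F)) <= rk (G `|` S).
  apply: indep_le_rk; [|solve_measurable|].
    by apply: (@indep_sub _ F) => //; [solve_measurable|move=> x [/GF|[]]].
  by apply: setUS => x [/XSG[]].
rewrite measU//; last by apply/seteqP; split=> // x [Gx [/XSG[]]].
by have := meas_ge0 (X `&` F); lra.
Qed.
End Rank.

(** * Packings and their modifications *)

Section Packing.
Variables (k : nat) (FF : 'I_k -> set (set J)).
Hypothesis M : forall i, measurable_matroid mu (FF i).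
Variable A : set J.
Hypothesis mA : measurable A.

Definition indep_family (F : 'I_k -> set J) :=
  forall i, FF i (F i) /\ F i `<=` A.

(** Along an augmenting path an element may be covered twice for a while, so
    coverage is counted. *)
Definition multiplicity (F : 'I_k -> set J) (x : J) : nat :=
  (\sum_(i < k) (x \in F i))%N.

Definition packing (F : 'I_k -> set J) :=
  indep_family F /\ forall x, (multiplicity F x <= 1)%N.

Definition cover (F : 'I_k -> set J) : set J := \bigcup_i F i.

Definition change (F H : 'I_k -> set J) : set J := \bigcup_i (F i `+` H i).

Definition update (F : 'I_k -> set J) i (X : set J) : 'I_k -> set J :=
  fun j => if j == i then X else F j.

Lemma indep_family_measurable F i : indep_family F -> measurable (F i).
Proof. by move=> /(_ i)[/(indep_measurable (M i))]. Qed.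

Lemma cover_measurable F : indep_family F -> measurable (cover F).
Proof. by move=> fF; apply: bigcupI_measurable => i; exact: indep_family_measurable. Qed.

Lemma change_measurable F H : indep_family F -> indep_family H ->
  measurable (change F H).
Proof.
move=> fF fH; apply: bigcupI_measurable => i.
have := indep_family_measurable i fF; have := indep_family_measurable i fH.
by move=> *; rewrite /setY; solve_measurable.
Qed.

Lemma change_refl F : meas (change F F) = 0.
Proof.
rewrite /change (_ : bigcup _ _ = set0) ?meas0//.
by apply/seteqP; split=> // x [i _]; rewrite setYK.
Qed.

Lemma change_triangle F H K : change F K `<=` change F H `|` change H K.
Proof.
move=> x [i _ [[Fx Kx]|[Kx Fx]]].
- have [Hx|Hx] := pselect (H i x); [right|left]; exists i => //; left; split=> //.
- have [Hx|Hx] := pselect (H i x); [left|right]; exists i => //; right; split=> //.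
Qed.

Lemma coverD_change F H : cover F `\` cover H `<=` change F H.
Proof.
by move=> x [[i _ Fx] nHx]; exists i => //; left; split=> // Hx; apply: nHx; exists i.
Qed.

Lemma multiplicity_gt0 F x : (0 < multiplicity F x)%N <-> cover F x.
Proof.
rewrite lt0n /multiplicity sum_nat_eq0 negb_forall; split.
  by move=> /existsP[i /=]; rewrite eqb0 negbK inE; exists i.
by move=> [i _ Fx]; apply/existsP; exists i; rewrite /= eqb0 negbK inE.
Qed.

Lemma packing_disjoint F : packing F -> forall i j, i != j -> F i `&` F j = set0.
Proof.
move=> [_ F1] i j ij; apply/seteqP; split=> // x [Fi Fj].
have := F1 x; rewrite /multiplicity (bigD1 i)//= (bigD1 j) 1?eq_sym//=.
by rewrite !mem_set.
Qed.

(** In this form the identity involves no subtraction, and identities for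
    successive exchanges can simply be added. *)
Lemma multiplicity_update F i X Y x : Y `<=` F i -> X `&` F i = set0 ->
  (multiplicity (update F i ((F i `\` Y) `|` X)) x + (x \in Y) =
   multiplicity F x + (x \in X))%N.
Proof.
move=> YF XF.
have YF' : x \in Y -> x \in F i by rewrite !inE; exact: YF.
have XF' : x \in X -> x \notin F i.
  by rewrite !inE => Xx; apply/negP; rewrite inE => Fx; have : (X `&` F i) x by []; rewrite XF.
rewrite /multiplicity (bigD1 i)//= [in RHS](bigD1 i)//=.
rewrite /update eqxx; under eq_bigr => j /negbTE -> do [].
have e : ((x \in (F i `\` Y) `|` X) + (x \in Y) = (x \in F i) + (x \in X) :> nat)%N.
  rewrite in_setU in_setD; move: YF' XF'.
  case: (x \in Y); case: (x \in F i); case: (x \in X) => //= h1 h2;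
    first [by have := h1 isT|by have := h2 isT].
by rewrite addnAC e addnAC.
Qed.

Lemma change_update F i X Y : change F (update F i ((F i `\` Y) `|` X)) `<=` X `|` Y.
Proof.
move=> x [j _]; rewrite /update; case: eqP => [->|_]; last by rewrite setYK.
case=> [[Fx n]|[[[]//|Xx] _]]; last by left.
by right; apply: contrapT => Yx; apply: n; left.
Qed.

Lemma indep_family_update F i X : indep_family F -> FF i X -> X `<=` A ->
  indep_family (update F i X).
Proof. by move=> fF fX XA j; rewrite /update; case: eqP => [->|_]. Qed.

Lemma packing_meas_cover F : packing F ->
  meas (cover F) = \sum_(i < k) meas (F i).
Proof.
move=> pF; apply: meas_bigcup_sum; last exact: packing_disjoint.
by move=> i; apply: indep_family_measurable; case: pF.
Qed.

(** * Augmenting paths *)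

(** S consists of elements from which an augmenting path of cost L leads back to
    the uncovered set: on small sets Y2 inside S, one covering of Y2 can be
    traded for a covering of an uncovered set X of the same measure.  The family
    H on which this is done need not be F: it only has to contain the part of F
    in S, so that exchanges outside S may have been made before. *)
Definition reroutable (F : 'I_k -> set J) (L : nat) (S : set J) : Prop :=
  forall Y, measurable Y -> Y `<=` S -> 0 < meas Y ->
  exists Y1, [/\ measurable Y1, Y1 `<=` Y, 0 < meas Y1 &
    forall Y2, measurable Y2 -> Y2 `<=` Y1 ->
    forall H, indep_family H -> (forall i, F i `&` S `<=` H i) ->
    exists H' X, [/\ indep_family H', measurable X, X `<=` A `\` cover F,
        meas X = meas Y2 &
        forall x, (multiplicity H' x + (x \in Y2) = multiplicity H x + (x \in X))%N] /\
      meas (change H H') <= L%:R * meas Y2].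

Lemma reroutable_uncovered F : reroutable F 0 (A `\` cover F).
Proof.
move=> Y mY YU Y0; exists Y; split=> // Y2 mY2 Y2Y H fH _.
exists H, Y2; split; first by split=> //; exact: subset_trans YU.
by rewrite mul0r change_refl.
Qed.

(** The next level is the uncovered set together with the minimal spans
    G i of S.  An element of G i outside S is traded for elements of S, and the
    path continues from there. *)
Lemma reroutable_step F L S : packing F -> measurable S ->
  A `\` cover F `<=` S -> S `<=` A ->
  (forall i, rk (FF i) (F i `|` S) <= meas (F i)) -> reroutable F L S ->
  exists S', [/\ measurable S', A `\` cover F `<=` S', S' `<=` A,
    reroutable F L.+2 S' &
    meas (A `\` cover F) + \sum_(i < k) rk (FF i) S <= meas S'].
Proof.
move=> pF mS US SA noaug rS; have [fF F1] := pF.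
have mF i : measurable (F i) by exact: indep_family_measurable.
have mU : measurable (A `\` cover F).
  by have := cover_measurable fF; move=> ?; solve_measurable.
have /choice[G GP] : forall i, exists G, [/\ measurable G, F i `&` S `<=` G, G `<=` F i,
    rk (FF i) (G `|` S) <= meas G &
    forall Y, measurable Y -> Y `<=` G `\` S -> 0 < meas Y ->
      meas (G `\` Y) < rk (FF i) ((G `\` Y) `|` S)].
  by move=> i; apply: (minimal_span (M i)) => //; case: (fF i).
have mG i : measurable (G i) by case: (GP i).
have mGU : measurable (\bigcup_i G i) by exact: bigcupI_measurable.
have GF i : G i `<=` F i by case: (GP i).
have fG i : FF i (G i) by apply: (indep_sub (M i)) (GF i) => //; case: (fF i).
have GS i : rk (FF i) (G i `|` S) <= meas (G i) by case: (GP i).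
have FS' i : G i `<=` F i `&` (A `\` cover F `|` \bigcup_i G i).
  by move=> x Gx; split; [exact: GF|right; exists i].
have FSG i : F i `&` S `<=` G i by case: (GP i).
exists ((A `\` cover F) `|` \bigcup_i G i); split.
- solve_measurable.
- exact: subsetUl.
- move=> x [[]//|[i _ /GF]]; case: (fF i) => _; apply.
- move=> Y mY YS' Y0.
  have [YS0|YS0] := ltP 0 (meas (Y `&` S)).
    have mYS : measurable (Y `&` S) by solve_measurable.
    have [Y1 [mY1 Y1Y Y10 h]] := rS _ mYS (@subIsetr _ _ _) YS0.
    exists Y1; split=> //; first by move=> x /Y1Y[].
    move=> Y2 mY2 Y21 H fH FSH; have [|H' [X [h1 h2]]] := h Y2 mY2 Y21 H fH.
      by move=> i x /FSG/FS'/FSH.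
    exists H', X; split=> //; apply: le_trans h2 _.
    by apply: ler_wpM2r; rewrite ?meas_ge0// ler_nat -addn2 leq_addr.
  (* outside S, the set Y is covered by the finitely many G i *)
  have [i i0] : exists i, 0 < meas ((Y `\` S) `&` G i).
    apply: contrapT => /forallNP n0.
    have mYS : measurable (Y `\` S) by solve_measurable.
    have mI i : measurable ((Y `\` S) `&` G i) by have := mG i; move=> ?; solve_measurable.
    have : meas (Y `\` S) <= 0.
      apply: le_trans (_ : \sum_(i < k) meas ((Y `\` S) `&` G i) <= _); last first.
        by apply: sumr_le0 => i _; rewrite leNgt; apply/negP.
      apply: le_trans (meas_bigcup_sum_le mI); apply: meas_le => //.
        exact: bigcupI_measurable.
      move=> x [Yx nSx]; case: (YS' _ Yx) => [/US//|[i _ Gx]].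
      by exists i.
    by move: Y0 YS0; rewrite (measDI mY mS); have := meas_ge0 (Y `&` S); lra.
  have mGi := mG i; have fGi := fG i; have GSi := GS i.
  pose Y' := (Y `\` S) `&` G i.
  have mY' : measurable Y' by rewrite /Y'; solve_measurable.
  have Y'GS : Y' `<=` G i `\` S by move=> x [[]].
  have Gmin : meas (G i `\` Y') < rk (FF i) ((G i `\` Y') `|` S).
    by case: (GP i) => _ _ _ _; apply.
  have [X [Z [[mX XSG X0 mZ ZY'] [ZX fZX]]]] :=
    exchange_positive (M i) fGi mS mY' GSi Y'GS Gmin.
  have XS : X `<=` S by move=> x /XSG[].
  have ZG : Z `<=` G i by move=> x /ZY'/Y'GS[].
  have [X1 [mX1 X1X X10 rX1]] := rS _ mX XS X0.
  have X1G : X1 `&` G i = set0.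
    by apply/seteqP; split=> // x [/X1X/XSG[]].
  have GX1 : rk (FF i) (G i `|` X1) <= meas (G i).
    apply: le_trans GSi; apply: (rk_le (M i)); [solve_measurable|solve_measurable|].
    by apply: setUS; exact: subset_trans XS.
  have fZX1 : FF i ((G i `\` Z) `|` X1).
    by apply: (indep_sub (M i)) fZX _; [solve_measurable|exact: setUS].
  have [Z1 [mZ1 Z1Z Z1X1 fZ1]] := exchange_within (M i) fGi mX1 mZ ZG X1G fZX1 GX1.
  have Z1G : Z1 `<=` G i by exact: subset_trans ZG.
  exists Z1; split; [by []| |by rewrite Z1X1|].
    by move=> x /Z1Z/ZY'[[]].
  move=> Y2 mY2 Y21 H fH FSH.
  have mHi := indep_family_measurable i fH; have [fHi HiA] := fH i.
  have GH : G i `<=` H i by move=> x /FS'/FSH.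
  have Y2G : Y2 `<=` G i by exact: subset_trans Z1G.
  have [W [mW WX1 WY2 fW]] :=
    exchange_reverse (M i) fGi mX1 mY2 X1G Z1G Y21 mZ1 Z1X1 fZ1 GX1.
  have WSG : W `<=` S `\` G i by move=> x /WX1/X1X/XSG.
  have W0 := span_indep_null (M i) fHi GH mGi mS mW WSG GSi.
  (* W is disjoint from H i up to a null set, by [span_indep_null]; removing it
     keeps the identity for multiplicities exact *)
  pose W' := W `\` H i.
  have mW' : measurable W' by rewrite /W'; solve_measurable.
  have W'Y2 : meas W' = meas Y2 by have := measDI mW mHi; rewrite W0 addr0 -/W' WY2.
  have W'W : W' `<=` W by exact: subDsetl.
  have W'H : W' `&` H i = set0 by rewrite /W' setDE -setIA setICl setI0.
  have fW' : FF i ((G i `\` Y2) `|` W').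
    by apply: (indep_sub (M i)) fW _; [solve_measurable|exact: setUS].
  have GW' : rk (FF i) (G i `|` W') <= meas (G i).
    apply: le_trans GSi; apply: (rk_le (M i)); [solve_measurable|solve_measurable|].
    by apply: setUS => x /W'W/WSG[].
  have fK := exchange_superset (M i) fHi GH mGi mW' mY2 Y2G W'H W'Y2 GW' fW'.
  pose K := update H i ((H i `\` Y2) `|` W').
  have iK : indep_family K.
    apply: indep_family_update => // x [[/HiA]//|/W'W/WSG[/SA]//].
  have FSK j : F j `&` S `<=` K j.
    rewrite /K /update; case: eqP => [->|_]; last by move=> x /FSG/FS'/FSH.
    move=> x Fx; left; split; first by apply/GH/FSG.
    by move=> /Y21/Z1Z/ZY'[[_ +]]; case: Fx.
  have W'X1 : W' `<=` X1 by exact: subset_trans WX1.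
  have [H' [X2 [[fH' mX2 X2U X2W' multH'] dH']]] := rX1 W' mW' W'X1 K iK FSK.
  exists H', X2; split.
    split=> //; first by rewrite X2W'.
    move=> x; move: (multH' x) (@multiplicity_update H i W' Y2 x (subset_trans Y2G GH) W'H).
    rewrite -/K; move: (multiplicity H' x) (multiplicity K x) (multiplicity H x).
    by move: (nat_of_bool _) (nat_of_bool _) (nat_of_bool _); clear; lia.
  have := meas_le (change_measurable fH fH') _ (@change_triangle H K H').
  have mHK := change_measurable fH iK; have mKH' := change_measurable iK fH'.
  move=> /(_ (measurableU _ _ mHK mKH')) h.
  have := measU_le mHK mKH'.
  have := meas_le mHK (measurableU _ _ mW' mY2) (@change_update H i W' Y2).
  have := measU_le mW' mY2; move: dH' h; rewrite W'Y2 -addn2 natrD mulrDl; lra.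
- rewrite measU//; last first.
    apply/seteqP; split=> // x [[_ nF] [i _ Gx]]; apply: nF; exists i => //.
    exact: GF.
  rewrite lerD2l meas_bigcup_sum//; last first.
    move=> i j ij; apply/seteqP; split=> // x [/GF Fi /GF Fj].
    by rewrite -(packing_disjoint pF ij).
  apply: ler_sum => i _; apply: le_trans (GS i); apply: (rk_le (M i)) => //.
  by have := mG i => ?; solve_measurable.
Qed.
Definition slack_condition (eps : R) : Prop :=
  forall X, measurable X -> X `<=` A ->
  Num.min (\sum_(i < k) rk (FF i) A) ((1 + eps) * meas X) <= \sum_(i < k) rk (FF i) X.

Lemma uncovered_measurable F : indep_family F -> measurable (A `\` cover F).
Proof. by move=> /cover_measurable ?; solve_measurable. Qed.

(** Adding a small part of S to F i covers it twice; rerouting it then covers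
    an uncovered set instead. *)
Lemma augment_from_sink F L S i : packing F -> measurable S -> S `<=` A ->
  reroutable F L S -> meas (F i) < rk (FF i) (F i `|` S) ->
  exists F', [/\ packing F', cover F `<=` cover F',
    meas (A `\` cover F') < meas (A `\` cover F) &
    meas (change F F') <=
      L.+1%:R * (meas (A `\` cover F) - meas (A `\` cover F'))].
Proof.
move=> pF mS SA rS sink; have [fF F1] := pF; have [fFi FiA] := fF i.
have mFi := indep_family_measurable i fF.
have mFS : measurable (F i `|` S) by solve_measurable.
have [B [fB FB BFS mB]] := rank_extension (M i) fFi mFS (@subsetUl _ _ _).
have bB := indep_measurable (M i) fB.
pose X := B `\` F i.
have mX : measurable X by rewrite /X; solve_measurable.
have X0 : 0 < meas X by rewrite /X measD// subr_gt0 mB.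
have XS : X `<=` S by move=> x [/BFS[]].
have [X1 [mX1 X1X X10 h]] := rS _ mX XS X0.
have X1F : X1 `&` F i = set0.
  by apply/seteqP; split=> // x [/X1X[]].
pose H := update F i ((F i `\` set0) `|` X1).
have fH : indep_family H.
  apply: indep_family_update => //.
    apply: (indep_sub (M i)) fB _; rewrite setD0; first solve_measurable.
    by move=> x [/FB|/X1X[]].
  by rewrite setD0 => x [/FiA|/X1X/XS/SA].
have FSH j : F j `&` S `<=` H j.
  rewrite /H /update; case: eqP => [->|_ x []//].
  by rewrite setD0 => x [? _]; left.
have [F' [Y [[fF' mY YU YX1 multF'] dF']]] := h X1 mX1 (@subset_refl _ _) H fH FSH.
have {}multF' x : multiplicity F' x = (multiplicity F x + (x \in Y))%N.
  move: (multF' x) (multiplicity_update x (@sub0set _ (F i)) X1F).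
  by rewrite -/H in_set0 addn0 => + e; rewrite e addnAC => /addIn.
have coverF' : cover F' = cover F `|` Y.
  apply/seteqP; split=> x.
    move=> /multiplicity_gt0; rewrite multF' addn_gt0 => /orP[/multiplicity_gt0|].
      by left.
    by rewrite lt0b inE; right.
  move=> cx; apply/multiplicity_gt0; rewrite multF' addn_gt0.
  by case: cx => [/multiplicity_gt0 ->//|Yx]; rewrite (mem_set Yx) orbT.
have mU := uncovered_measurable fF; have mU' := uncovered_measurable fF'.
have gain : meas (A `\` cover F') = meas (A `\` cover F) - meas Y.
  by rewrite coverF' -setDDl measD.
exists F'; split.
- split=> // x; rewrite multF'; case: (boolP (x \in Y)); last by rewrite addn0.
  rewrite inE => /YU[_ nFx].
  case: (posnP (multiplicity F x)) => [->//|/multiplicity_gt0].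
  by move=> /nFx.
- by rewrite coverF'; exact: subsetUl.
- by rewrite gain; rewrite YX1; lra.
- rewrite gain opprB addrCA subrr addr0 YX1.
  have mFH := change_measurable fF fH; have mHF' := change_measurable fH fF'.
  have := meas_le (change_measurable fF fF') (measurableU _ _ mFH mHF')
    (@change_triangle F H F').
  have := measU_le mFH mHF'.
  have := meas_le mFH (measurableU _ _ mX1 measurable0) (@change_update F i X1 set0).
  by rewrite setU0 -addn1 natrD mulrDl; lra.
Qed.

(** Without an augmentation the levels would grow geometrically inside the set A
    of finite measure.  When the minimum in the slack condition is the total
    rank, F itself has full total rank, contrary to assumption. *)
Lemma augment F (eps : R) : 0 < eps -> slack_condition eps -> packing F ->
  0 < meas (A `\` cover F) -> meas (cover F) < \sum_(i < k) rk (FF i) A ->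
  exists n F', [/\ packing F', cover F `<=` cover F',
    meas (A `\` cover F') < meas (A `\` cover F),
    meas (change F F') <=
      n.*2.+1%:R * (meas (A `\` cover F) - meas (A `\` cover F')) &
    (1 + eps) ^+ n * meas (A `\` cover F) <= meas A].
Proof.
move=> eps0 sat pF u0 Fr; have [fF _] := pF.
have mU := uncovered_measurable fF.
apply: contrapT => noaug.
have levels n : exists S, [/\ measurable S, A `\` cover F `<=` S, S `<=` A,
    reroutable F n.*2 S & (1 + eps) ^+ n * meas (A `\` cover F) <= meas S].
  elim: n => [|n [S [mS US SA rS hS]]].
    exists (A `\` cover F); rewrite expr0 mul1r; split=> //.
    exact: reroutable_uncovered.
  have hSA : (1 + eps) ^+ n * meas (A `\` cover F) <= meas A.
    by apply: le_trans hS _; exact: meas_le.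
  have nosink i : rk (FF i) (F i `|` S) <= meas (F i).
    rewrite leNgt; apply/negP => /(augment_from_sink pF mS SA rS)[F' [h1 h2 h3 h4]].
    by apply: noaug; exists n, F'.
  have [S' [mS' US' S'A rS' hS']] := reroutable_step pF mS US SA nosink rS.
  exists S'; split=> //.
  have rkSF : \sum_(i < k) rk (FF i) S <= meas (cover F).
    rewrite packing_meas_cover//; apply: ler_sum => i _.
    apply: le_trans (nosink i); apply: (rk_le (M i)) => //.
    by have := indep_family_measurable i fF => ?; solve_measurable.
  have := sat S mS SA; rewrite ge_min => /orP[h|h].
    by move: Fr; rewrite ltNge (le_trans h).
  rewrite exprS -mulrA; apply: le_trans hS'.
  have : (1 + eps) * ((1 + eps) ^+ n * meas (A `\` cover F)) <= (1 + eps) * meas S.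
    by rewrite ler_pM2l//; lra.
  lra.
have bern n : 1 + n%:R * eps <= (1 + eps) ^+ n.
  elim: n => [|n ih]; first by rewrite mul0r addr0 expr0.
  rewrite exprS; apply: le_trans (_ : (1 + eps) * (1 + n%:R * eps) <= _).
    have : 0 <= n%:R * eps * eps by rewrite !mulr_ge0 ?ler0n ?ltW.
    by rewrite -natr1; nra.
  by rewrite ler_pM2l//; lra.
have ue0 : 0 < eps * meas (A `\` cover F) by rewrite mulr_gt0.
pose n := Num.bound (meas A / (eps * meas (A `\` cover F))).
have : meas A < n%:R * (eps * meas (A `\` cover F)).
  rewrite -ltr_pdivrMr//; apply: archi_boundP.
  by rewrite divr_ge0 ?meas_ge0// ltW.
have [S [mS _ SA _ hS]] := levels n.
have := meas_le mS mA SA.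
have : (1 + n%:R * eps) * meas (A `\` cover F) <= (1 + eps) ^+ n * meas (A `\` cover F).
  by rewrite ler_pM2r.
nra.
Qed.
Lemma packing_of_disjoint F : indep_family F ->
  (forall i j, i != j -> F i `&` F j = set0) -> packing F.
Proof.
move=> fF dF; split=> // x.
have [[i Fx]|nF] := pselect (exists i, F i x).
  rewrite /multiplicity (bigD1 i)//= big1 ?addn0 ?leq_b1// => j ji.
  rewrite memNset// => Fjx; have : (F j `&` F i) x by [].
  by rewrite dF.
by rewrite /multiplicity big1// => i _; rewrite memNset// => Fx; apply: nF; exists i.
Qed.

(** * Limits of improving sequences *)

Definition eventually_in (s : nat -> 'I_k -> set J) : 'I_k -> set J :=
  fun i => \bigcup_n \bigcap_m s (n + m)%N i.

Lemma eventually_in_packing (s : nat -> 'I_k -> set J) :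
  (forall n, packing (s n)) -> packing (eventually_in s).
Proof.
move=> ps.
have ms n i : measurable (s n i) by apply: indep_family_measurable; case: (ps n).
have sub n i : \bigcap_m s (n + m)%N i `<=` s n i by move=> x /(_ 0%N I); rewrite addn0.
apply: packing_of_disjoint => [i|i j ij].
- split.
    apply: (indep_bigcup (M i)) => n.
      apply: (indep_sub (M i)) (sub n i); first exact: bigcap_measurable.
      by case: (ps n) => /(_ i)[].
    by move=> x xn m _; rewrite addSnnS; exact: xn.
  by apply: bigcup_sub => n _; apply: subset_trans (sub n i) _; case: (ps n) => /(_ i)[].
- apply/seteqP; split=> // x [[n _ xi] [m _ xj]].
  rewrite -(packing_disjoint (ps (n + m)%N) ij); split; first exact: xi.
  by rewrite addnC; exact: xj.
Qed.

Lemma change_eventually_in (s : nat -> 'I_k -> set J) n :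
  change (s n) (eventually_in s) `<=` \bigcup_m change (s (n + m)%N) (s (n + m).+1).
Proof.
move=> x [i _ h]; apply: contrapT => nx.
have const m : s (n + m)%N i x <-> s n i x.
  elim: m => [|m ih]; first by rewrite addn0.
  rewrite -ih addnS; split=> hx; apply: contrapT => hx'; apply: nx;
    exists m => //; exists i => //; [by right|by left].
case: h => [[sx]|[[p _ px] nsx]].
  by apply; exists n => // m _; apply/const.
by apply: nsx; apply/(const p); rewrite addnC; exact: px.
Qed.

(** The square root is one choice of a function whose derivative dominates the
    length O(log(1/u)) of the augmenting paths and is integrable at 0. *)
Definition potential (F : 'I_k -> set J) : R := Num.sqrt (meas (A `\` cover F)).

(** The preorder of Ekeland's variational principle for the distance
    [meas (change F H)]. *)
Definition improves (c : R) (F H : 'I_k -> set J) : Prop :=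
  meas (cover F `\` cover H) = 0 /\
  meas (change F H) <= c * (potential F - potential H).

Lemma improves_refl (c : R) F : improves c F F.
Proof. by split; rewrite ?setDv ?meas0// change_refl subrr mulr0. Qed.

Lemma coverD_trans F H K : indep_family F -> indep_family H -> indep_family K ->
  meas (cover F `\` cover K) <= meas (cover F `\` cover H) + meas (cover H `\` cover K).
Proof.
move=> /cover_measurable mF /cover_measurable mH /cover_measurable mK.
have m1 : measurable (cover F `\` cover H) by solve_measurable.
have m2 : measurable (cover H `\` cover K) by solve_measurable.
apply: le_trans (measU_le m1 m2); apply: meas_le; [solve_measurable|solve_measurable|].
move=> x [Fx Kx]; have [Hx|Hx] := pselect (cover H x); first by right.
by left.
Qed.

Lemma improves_trans (c : R) F H K : packing F -> packing H -> packing K ->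
  improves c F H -> improves c H K -> improves c F K.
Proof.
move=> [fF _] [fH _] [fK _] [FH dFH] [HK dHK]; split.
  apply/eqP; rewrite eq_le meas_ge0 andbT.
  by apply: le_trans (coverD_trans fF fH fK) _; rewrite FH HK addr0.
have mFH := change_measurable fF fH; have mHK := change_measurable fH fK.
have := meas_le (change_measurable fF fK) (measurableU _ _ mFH mHK) (@change_triangle F H K).
by have := measU_le mFH mHK; move: dFH dHK; rewrite !mulrBr; lra.
Qed.

Lemma uncovered_le F H : indep_family F -> indep_family H ->
  meas (A `\` cover H) <= meas (A `\` cover F) + meas (cover F `\` cover H).
Proof.
move=> /cover_measurable mF /cover_measurable mH.
have m1 : measurable (A `\` cover F) by solve_measurable.
have m2 : measurable (cover F `\` cover H) by solve_measurable.
apply: le_trans (measU_le m1 m2); apply: meas_le; [solve_measurable|solve_measurable|].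
move=> x [Ax Hx]; have [Fx|Fx] := pselect (cover F x); first by right.
by left.
Qed.

Lemma improves_potential (c : R) F H : packing F -> packing H ->
  improves c F H -> potential H <= potential F.
Proof.
move=> [fF _] [fH _] [FH _]; rewrite /potential ler_wsqrtr//.
by apply: le_trans (uncovered_le fF fH) _; rewrite FH addr0.
Qed.

(** The limit differs from s n by at most the sum of the later changes, which
    telescopes to c times the remaining decrease of the potential; this forces
    the potential of the limit below the infimum l. *)
Lemma improves_limit (c : R) (s : nat -> 'I_k -> set J) : 0 <= c ->
  (forall n, packing (s n)) -> (forall n, improves c (s n) (s n.+1)) ->
  forall n, improves c (s n) (eventually_in s).
Proof.
move=> c0 ps smon.
have fs n : indep_family (s n) by case: (ps n).
have pL := eventually_in_packing ps; have [fL _] := pL.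
have impr n m : improves c (s n) (s (n + m)%N).
  elim: m => [|m ih]; first by rewrite addn0; exact: improves_refl.
  by rewrite addnS; apply: improves_trans ih _.
pose l := inf (range (potential \o s)).
have hl : has_inf (range (potential \o s)).
  split; first by exists (potential (s 0%N)), 0%N.
  by exists 0 => _ [n _ <-]; rewrite sqrtr_ge0.
have l_le n : l <= potential (s n) by apply: ge_inf; [case: hl|exists n].
have l0 : 0 <= l.
  apply: lb_le_inf; first by case: hl.
  by move=> _ [n _ <-]; rewrite sqrtr_ge0.
have l_adh n e : 0 < e -> exists2 m, (n <= m)%N & potential (s m) < l + e.
  move=> e0; have [_ [m _ <-] /= me] := inf_adherent e0 hl.
  exists (n + m)%N; first exact: leq_addr.
  apply: le_lt_trans me; rewrite addnC.
  exact: improves_potential (ps _) (ps _) (impr m n).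
have dL n : meas (change (s n) (eventually_in s)) <= c * (potential (s n) - l).
  have md m : measurable (change (s (n + m)%N) (s (n + m).+1)) by exact: change_measurable.
  apply: le_trans (_ : meas (\bigcup_m change (s (n + m)%N) (s (n + m).+1)) <= _).
    apply: meas_le; [exact: change_measurable|exact: bigcup_measurable|].
    exact: change_eventually_in.
  apply: meas_bigcup_series_le => // p.
  apply: le_trans (_ : c * (potential (s n) - potential (s (n + p)%N)) <= _); last first.
    by rewrite ler_wpM2l// lerD2l lerN2.
  elim: p => [|p ih]; first by rewrite big_ord0 addn0 subrr mulr0.
  rewrite big_ord_recr/= addnS; have [_] := smon (n + p)%N.
  by move: ih; rewrite !mulrBr; lra.
have uL : meas (A `\` cover (eventually_in s)) <= l ^+ 2.
  apply/ler_addgt0Pr => e e0.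
  pose b := 2 * l + 1 + c.
  have b0 : 0 < b by rewrite /b; lra.
  have e'0 : 0 < Num.min 1 (e / b) by rewrite lt_min ltr01 divr_gt0.
  have [n _ ne] := l_adh 0%N _ e'0.
  have := uncovered_le (fs n) fL.
  have mc := cover_measurable (fs n); have mcL := cover_measurable fL.
  have : meas (cover (s n) `\` cover (eventually_in s)) <= c * (potential (s n) - l).
    apply: le_trans (dL n); apply: meas_le; first solve_measurable.
      exact: change_measurable.
    exact: coverD_change.
  have -> : meas (A `\` cover (s n)) = potential (s n) ^+ 2.
    by rewrite /potential sqr_sqrtr// meas_ge0.
  have [x ex] : exists x, potential (s n) = l + x.
    by exists (potential (s n) - l); rewrite addrC subrK.
  move: ne (l_le n); rewrite ex lerDl ltrD2l [l + x]addrC addrK => xl x0.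
  have x1 : x <= 1 by apply/ltW/(lt_le_trans xl); rewrite ge_min lexx.
  have xb : b * x <= e.
    rewrite mulrC -ler_pdivlMr//; apply/ltW/(lt_le_trans xl).
    by rewrite ge_min lexx orbT.
  move: xb; rewrite /b; nra.
have potL : potential (eventually_in s) <= l.
  by rewrite -[leRHS]ger0_norm// -sqrtr_sqr ler_wsqrtr.
move=> n; split; last first.
  by apply: le_trans (dL n) _; rewrite ler_wpM2l// lerD2l lerN2.
apply/eqP; rewrite eq_le meas_ge0 andbT; apply/ler_addgt0Pr => e e0; rewrite add0r.
have e'0 : 0 < e / (c + 1) by rewrite divr_gt0//; lra.
have [m nm me] := l_adh n _ e'0.
apply: le_trans (coverD_trans (fs n) (fs m) fL) _.
have [-> _] : improves c (s n) (s m) by rewrite -(subnKC nm).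
rewrite add0r; apply: le_trans (_ : c * (potential (s m) - l) <= _).
  have mc := cover_measurable (fs m); have mcL := cover_measurable fL.
  apply: le_trans (dL m); apply: meas_le; first solve_measurable.
    exact: change_measurable.
  exact: coverD_change.
have : (potential (s m) - l) * (c + 1) <= e.
  by rewrite -ler_pdivlMr; lra.
by have := l_le m; nra.
Qed.

Lemma sqrt1D_gt1 (eps : R) : 0 < eps -> 1 < Num.sqrt (1 + eps).
Proof. by move=> eps0; rewrite -[ltLHS]sqrtr1 ltr_sqrt//; lra. Qed.

(** Bernoulli's inequality for the square root q of 1 + eps gives growth linear
    in n for the square root of (1 + eps) ^+ n, which is all that is needed. *)
Lemma path_cost_le (eps a u : R) n : 0 < eps -> 0 <= u ->
  (1 + eps) ^+ n * u <= a ->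
  n.*2.+1%:R * Num.sqrt u <=
    2 * (Num.sqrt a / (Num.sqrt (1 + eps) - 1)) + Num.sqrt a.
Proof.
move=> eps0 u0 h.
set q := Num.sqrt (1 + eps).
have q1 : 1 < q by exact: sqrt1D_gt1.
have bern : 1 + n%:R * (q - 1) <= q ^+ n.
  elim: n {h} => [|n ih]; first by rewrite mul0r addr0 expr0.
  rewrite exprS; apply: le_trans (_ : q * (1 + n%:R * (q - 1)) <= _).
    have : 0 <= n%:R * ((q - 1) * (q - 1)) by rewrite !mulr_ge0 ?ler0n//; lra.
    by rewrite -natr1; nra.
  by rewrite ler_pM2l//; lra.
have hq : q ^+ n * Num.sqrt u <= Num.sqrt a.
  have -> : q ^+ n * Num.sqrt u = Num.sqrt ((1 + eps) ^+ n * u).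
    rewrite sqrtrM; last by rewrite exprn_ge0//; lra.
    congr (_ * _); rewrite -[1 + eps]sqr_sqrtr -/q; last by lra.
    by rewrite exprAC sqrtr_sqr ger0_norm// exprn_ge0//; lra.
  exact: ler_wsqrtr.
have su0 : 0 <= Num.sqrt u by exact: sqrtr_ge0.
have hn : (1 + n%:R * (q - 1)) * Num.sqrt u <= Num.sqrt a.
  by apply: le_trans hq; apply: ler_wpM2r.
have n0 : 0 <= n%:R * (q - 1) * Num.sqrt u by rewrite !mulr_ge0 ?ler0n//; lra.
have hn2 : n%:R * Num.sqrt u <= Num.sqrt a / (q - 1).
  by rewrite ler_pdivlMr; [nra|lra].
rewrite -addn1 -muln2 natrD natrM; nra.
Qed.

(** A packing that is maximal for [improves] cannot be augmented: by
    u - u' = (sqrt u - sqrt u') (sqrt u + sqrt u') and [path_cost_le], every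
    augmentation is an improvement for the constant 2 * C. *)
Lemma saturating_packing F0 (eps : R) : 0 < eps -> slack_condition eps ->
  packing F0 -> exists F, [/\ packing F, meas (cover F0 `\` cover F) = 0 &
    meas (cover F) = Num.min (meas A) (\sum_(i < k) rk (FF i) A)].
Proof.
move=> eps0 sat pF0.
pose C := 2 * (Num.sqrt (meas A) / (Num.sqrt (1 + eps) - 1)) + Num.sqrt (meas A).
have C0 : 0 <= C.
  have /ltW q1 := sqrt1D_gt1 eps0.
  by rewrite addr_ge0 ?sqrtr_ge0// mulr_ge0// divr_ge0 ?sqrtr_ge0 ?subr_ge0.
have [||||||F [pF [F0F _] Fmax]] := @brezis_browder_in R ('I_k -> set J) packing
  (improves (2 * C)) potential 0 _ _ _ _ _ F0.
- exact: improves_refl.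
- by move=> F H K; exact: improves_trans.
- by move=> F _; exact: sqrtr_ge0.
- by move=> F H; exact: improves_potential.
- move=> s ps smon; exists (eventually_in s); first exact: eventually_in_packing.
  by apply: improves_limit => //; rewrite mulr_ge0.
- by [].
exists F; split=> //; have [fF _] := pF.
have mc := cover_measurable fF; have mU := uncovered_measurable fF.
have cA : cover F `<=` A by apply: bigcup_sub => i _; case: (fF i).
have crk : meas (cover F) <= \sum_(i < k) rk (FF i) A.
  rewrite packing_meas_cover//; apply: ler_sum => i _.
  by have [? ?] := fF i; apply: (indep_le_rk (M i)).
have cAU : meas (A `\` cover F) = meas A - meas (cover F) by rewrite measD.
apply/eqP; rewrite eq_le le_min crk andbT meas_le//= ge_min.
rewrite leNgt [in X in _ || X]leNgt -negb_and; apply/negP => /andP[Au Fr].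
have u0 : 0 < meas (A `\` cover F) by rewrite cAU subr_gt0.
have [n [F' [pF' FF' uu' dFF' hn]]] := augment eps0 sat pF u0 Fr.
have cost := path_cost_le eps0 (ltW u0) hn.
have pot_lt : potential F' < potential F by rewrite /potential ltr_sqrt.
have p0 : 0 <= potential F' by exact: sqrtr_ge0.
have := Fmax F' pF'; rewrite /improves => /(_ _) e.
suff /e : improves (2 * C) F F' by move: pot_lt => /[swap] ->; rewrite ltxx.
split; first by rewrite (_ : _ `\` _ = set0) ?meas0//; rewrite setD_eq0.
apply: le_trans dFF' _.
have -> : meas (A `\` cover F) - meas (A `\` cover F') =
    (potential F - potential F') * (potential F + potential F').
  by rewrite -subr_sqr /potential !sqr_sqrtr ?meas_ge0.
move: cost; rewrite -/(potential F) -/C => cost.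
rewrite [leRHS]mulrC mulrCA ler_pM2l ?subr_gt0//.
have : n.*2.+1%:R * (potential F + potential F') <= n.*2.+1%:R * (2 * potential F).
  by rewrite ler_pM2l ?ltr0n//; lra.
lra.
Qed.
Lemma packing_empty : packing (fun=> set0).
Proof.
split=> [i|x]; first by split; [exact: matroid_empty (M i)|exact: sub0set].
by rewrite /multiplicity big1// => i _; rewrite in_set0.
Qed.

Lemma cover_sub F : indep_family F -> cover F `<=` A.
Proof. by move=> fF; apply: bigcup_sub => i _; case: (fF i). Qed.

Lemma cover_sum_family F : indep_family F -> sum_family mu FF (cover F).
Proof.
move=> fF; split; first exact: cover_measurable.
exists F; split; first by move=> i; case: (fF i).
by rewrite /ae_same setYK measure0.
Qed.

Lemma cover_measurable_union F : indep_family F -> measurable_union mu FF (cover F).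
Proof.
move=> fF; split; first exact: cover_measurable.
exists (fun=> cover F); split=> [n|n|].
- exact: cover_sum_family.
- exact: sub_ae_subset.
- by rewrite bigcup_const// /ae_same setYK measure0.
Qed.

End Packing.

(** * The measurable union *)

Section Union.
Variables (k : nat) (FF : 'I_k -> set (set J)).
Hypothesis M : forall i, measurable_matroid mu (FF i).

Lemma ae_same_setD (X Y : set J) : measurable X -> measurable Y ->
  ae_same mu X Y -> meas (X `\` Y) = 0.
Proof.
move=> mX mY; rewrite /ae_same /setY => /meas_eq0 h.
have mXY : measurable (X `\` Y) by solve_measurable.
have mYX : measurable (Y `\` X) by solve_measurable.
apply/eqP; rewrite eq_le meas_ge0 andbT -h; last exact: measurableU.
by apply: meas_le => //; exact: measurableU.
Qed.

Lemma sum_family_meas_le X Z : measurable Z -> sum_family mu FF X ->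
  meas (X `&` Z) <= \sum_(i < k) rk (FF i) Z.
Proof.
move=> mZ [mX [P [fP XP]]].
have mP i : measurable (P i) by exact: indep_measurable (M i) (P i) (fP i).
have mUP : measurable (\bigcup_i P i) by exact: bigcupI_measurable.
have mPZ i : measurable (P i `&` Z) by have := mP i => ?; solve_measurable.
have mUPZ : measurable (\bigcup_i (P i `&` Z)) by exact: bigcupI_measurable.
have mD : measurable (X `\` \bigcup_i P i) by solve_measurable.
apply: (@le_trans _ _ (meas (\bigcup_i (P i `&` Z)))).
  have := measU_le mD mUPZ; rewrite (ae_same_setD mX mUP XP) add0r; apply: le_trans.
  apply: meas_le; [solve_measurable|solve_measurable|].
  move=> x [Xx Zx]; have [[i _ Px]|nP] := pselect ((\bigcup_i P i) x); last by left.
  by right; exists i.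
apply: le_trans (meas_bigcup_sum_le mPZ) _; apply: ler_sum => i _.
by apply: (indep_le_rk (M i)) => //; apply: (indep_sub (M i)) (fP i) _.
Qed.

(** The sets S n increase only up to null sets, so they are replaced by their
    partial unions T n. *)
Lemma measurable_union_meas_le X Z : measurable Z -> measurable_union mu FF X ->
  meas (X `&` Z) <= \sum_(i < k) rk (FF i) Z.
Proof.
move=> mZ [mX [S [fS Smon XS]]].
have mS n : measurable (S n) by case: (fS n).
pose T n := \big[setU/set0]_(m < n.+1) S m.
have mT n : measurable (T n) by exact: bigsetU_measurable.
have TS n : meas (T n `\` S n) = 0.
  elim: n => [|n ih]; first by rewrite /T big_ord1 setDv meas0.
  have m1 : measurable (T n `\` S n) by have := mS n => ?; have := mT n => ?; solve_measurable.
  have m2 : measurable (S n `\` S n.+1).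
    by have := mS n => ?; have := mS n.+1 => ?; solve_measurable.
  apply/eqP; rewrite eq_le meas_ge0 andbT.
  have : meas (S n `\` S n.+1) = 0 by apply/ae_subsetE => //; exact: Smon.
  have := measU_le m1 m2; rewrite ih => + e; rewrite e addr0; apply: le_trans.
  apply: meas_le; [|exact: measurableU|].
    by have := mT n.+1 => ?; have := mS n.+1 => ?; solve_measurable.
  move=> x; rewrite /T big_ord_recr/= => -[[Tx|//] nS].
  by have [Sx|Sx] := pselect (S n x); [right|left].
have mU : measurable (\bigcup_n S n) by exact: bigcup_measurable.
have mTZ n : measurable (T n `&` Z) by have := mT n => ?; solve_measurable.
have mUTZ : measurable (\bigcup_n (T n `&` Z)) by exact: bigcup_measurable.
have mD : measurable (X `\` \bigcup_n S n) by solve_measurable.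
apply: (@le_trans _ _ (meas (\bigcup_n (T n `&` Z)))).
  have := measU_le mD mUTZ; rewrite (ae_same_setD mX mU XS) add0r; apply: le_trans.
  apply: meas_le; [solve_measurable|solve_measurable|].
  move=> x [Xx Zx]; have [[n _ Sx]|nP] := pselect ((\bigcup_n S n) x); last by left.
  by right; exists n => //; split=> //; rewrite /T big_ord_recr/=; right.
apply: meas_bigcup_le => // n.
  move=> x [Tx Zx]; split=> //; rewrite /T [X in X x]big_ord_recr/=.
  by left.
apply: le_trans (sum_family_meas_le mZ (fS n)).
have m1 : measurable (T n `\` S n) by have := mS n => ?; have := mT n => ?; solve_measurable.
have m2 : measurable (S n `&` Z) by have := mS n => ?; solve_measurable.
have := measU_le m1 m2; rewrite TS add0r; apply: le_trans.
apply: meas_le => //; first exact: measurableU.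
by move=> x [Tx Zx]; have [Sx|Sx] := pselect (S n x); [right|left].
Qed.

Variable A : set J.
Hypothesis mA : measurable A.
Variable eps : R.
Hypothesis eps0 : 0 < eps.
Hypothesis sat : slack_condition FF A eps.

Lemma slack_condition_sub B : measurable B -> B `<=` A -> slack_condition FF B eps.
Proof.
move=> mB BA X mX XB; apply: le_trans (sat mX (subset_trans XB BA)).
rewrite le_min !ge_min lexx orbT andbT; apply/orP; left.
by apply: ler_sum => i _; exact: (rk_le (M i)).
Qed.

Lemma packing_mono B F : B `<=` A -> packing FF B F -> packing FF A F.
Proof.
move=> BA [fF F1]; split=> // i; have [? FB] := fF i.
by split=> //; exact: subset_trans BA.
Qed.

(** The slack condition holds inside C `&` A as well, and there the minimum in
    [saturating_packing] is the measure of the set itself. *)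
Lemma measurable_union_packing C : measurable_union mu FF C ->
  exists2 F, packing FF A F & meas (C `&` A `\` cover F) = 0.
Proof.
move=> uC; have [mC _] := uC.
have mCA : measurable (C `&` A) by solve_measurable.
have CAA : C `&` A `<=` A by exact: subIsetr.
have [F [pF _ hF]] := saturating_packing M mCA eps0 (slack_condition_sub mCA CAA)
  (packing_empty M (C `&` A)).
exists F; first exact: packing_mono CAA pF.
have [fF _] := pF; have mF := cover_measurable M fF.
rewrite measD//; last exact: cover_sub fF.
rewrite hF min_l ?subrr//.
by have := measurable_union_meas_le mCA uC; rewrite setIA setIid.
Qed.

Let V := Num.min (meas A) (\sum_(i < k) rk (FF i) A).

Lemma restr_union_meas_le Y : restr mu (measurable_union mu FF) A Y -> meas Y <= V.
Proof.
move=> [uY YA]; have [mY _] := uY.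
move/ae_subsetE : YA => /(_ mY mA) YA.
rewrite (measDI mY mA) YA add0r le_min measurable_union_meas_le// andbT.
by apply: meas_le => //; solve_measurable.
Qed.

Lemma cover_maximal F : packing FF A F -> meas (cover F) = V ->
  maximal_in mu (restr mu (measurable_union mu FF) A) (cover F).
Proof.
move=> [fF _] hF; have mF := cover_measurable M fF.
split.
  split; first exact: (cover_measurable_union M fF).
  exact: (sub_ae_subset (cover_sub fF)).
move=> Y rY FY; have [[mY _] _] := rY.
move/ae_subsetE : FY => /(_ mF mY) FY; apply/ae_subsetE => //.
have := restr_union_meas_le rY.
have := measDI mF mY; rewrite FY hF add0r setIC => e.
by rewrite (measDI mY mF) -e; have := meas_ge0 (Y `\` cover F); lra.
Qed.

(** Pack C exactly and extend the packing inside A: by maximality C is the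
    whole set covered by the extension. *)
Lemma maximal_union_meas C :
  maximal_in mu (restr mu (measurable_union mu FF) A) C -> meas C = V.
Proof.
move=> [rC Cmax]; have [[mC [S [fS Smon CS]]] CA] := rC.
move/ae_subsetE : (CA) => /(_ mC mA) CA0.
have uC : measurable_union mu FF C by case: rC.
have [F0 pF0 CF0] := measurable_union_packing uC.
have [F [pF F0F hF]] := saturating_packing M mA eps0 sat pF0.
have [fF0 _] := pF0; have [fF _] := pF.
have mF0 := cover_measurable M fF0; have mF := cover_measurable M fF.
have CF : ae_subset mu C (cover F).
  apply/ae_subsetE => //; apply/eqP; rewrite eq_le meas_ge0 andbT.
  have m1 : measurable (C `\` A) by solve_measurable.
  have m2 : measurable (C `&` A `\` cover F0) by solve_measurable.
  have m3 : measurable (cover F0 `\` cover F) by solve_measurable.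
  have := measU_le (measurableU _ _ m1 m2) m3; rewrite F0F addr0 => h1.
  have := measU_le m1 m2; rewrite CA0 CF0 addr0 => h2.
  apply: le_trans h2; apply: le_trans h1; apply: meas_le; [solve_measurable|solve_measurable|].
  move=> x [Cx nFx]; have [Ax|Ax] := pselect (A x); last by left; left.
  by have [F0x|F0x] := pselect (cover F0 x); [right|left; right].
have [rF _] := cover_maximal pF hF.
have /ae_subsetE := Cmax _ rF CF => /(_ mF mC) FC.
apply/eqP; rewrite eq_le restr_union_meas_le//= /V -hF.
by rewrite (measDI mF mC) FC add0r; apply: meas_le => //; solve_measurable.
Qed.

End Union.
End FiniteMeasure.

Local Open Scope ereal_scope.

Theorem theorem6p25 (R : realType) (d : measure_display)
  (J : measurableType d) (mu : {finite_measure set J -> \bar R})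
  (hJ : standard_measure_space mu)
  (k : nat) (FF : 'I_k -> set (set J))
  (hFF : forall i, measurable_matroid mu (FF i))
  (A : set J) (mA : measurable A)
  (heps : exists2 eps : R, (0 < eps)%R &
    forall X : set J, measurable X -> ae_subset mu X A ->
      Order.min (\sum_(i < k) rank mu (FF i) A) ((1 + eps)%:E * mu X)
      <= \sum_(i < k) rank mu (FF i) X) :
  exists F : 'I_k -> set J,
    [/\ forall i, FF i (F i),
        forall i, ae_subset mu (F i) A,
        forall i j, i != j -> mu (F i `&` F j) = 0 &
        mu (\bigcup_i F i) =
          Order.min (mu A) (\sum_(i < k) rank mu (FF i) A)] /\
    [/\ rank mu (measurable_union mu FF) A =
          Order.min (mu A) (\sum_(i < k) rank mu (FF i) A),
        matroid_basis mu (restr mu (measurable_union mu FF) A) (\bigcup_i F i) &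
        sum_family mu FF (\bigcup_i F i)].
Proof.
have rank_sum X : measurable X ->
    \sum_(i < k) rank mu (FF i) X = (\sum_(i < k) rk mu (FF i) X)%R%:E.
  by move=> mX; rewrite -sumEFin; apply: eq_bigr => i _; exact: rank_fin (hFF i) _ mX.
have [eps eps0 heps'] := heps.
have sat : slack_condition mu FF A eps.
  move=> X mX XA; have := heps' X mX (sub_ae_subset mu XA).
  by rewrite !rank_sum// measE// -EFinM -EFin_min lee_fin.
have [F [pF _ hF]] := saturating_packing hFF mA eps0 sat (packing_empty hFF A).
have [fF _] := pF.
have -> : Order.min (mu A) (\sum_(i < k) rank mu (FF i) A) = mu (cover F).
  rewrite rank_sum// measE// -EFin_min -hF [RHS]measE//.
  exact: (cover_measurable hFF fF).
have Fmax := cover_maximal hFF mA pF hF.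
exists F; split; split=> //.
- by move=> i; case: (fF i).
- by move=> i; apply: sub_ae_subset; case: (fF i).
- by move=> i j ij; rewrite (packing_disjoint pF ij) measure0.
- rewrite /rank; case: xgetP => [C _ Cmax|/(_ (cover F))//].
  have [[[mC _] _] _] := Cmax.
  rewrite [LHS]measE// (maximal_union_meas hFF mA eps0 sat Cmax) -hF measE//.
  exact: (cover_measurable hFF fF).
- exact: (cover_sum_family hFF fF).
Qed.
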